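(* Let $p$ be a prime. For the sequence of cyclic groups $Cyc_n = \mathbb{Z}/(n+1)$, $n \ge 0$, $$\widetilde{OGF}(p,Cyc,x) = \sum_{n=0}^\infty p^{\nu_p(n+1)} x^n = \sum_{n=0}^\infty \frac{x^n}{|n+1|_p}.$$ For the sequence of binary cyclic groups $BinCyc_n = \mathbb{Z}/(2(n+1))$, $n \ge 0$, $$\widetilde{OGF}(p,BinCyc,x) = \sum_{n=0}^\infty p^{\nu_p(2(n+1))} x^n = \sum_{n=0}^\infty \frac{x^n}{|2(n+1)|_p}.$$
   Context: For a finite group $G$ and a prime $p$, $r(p,G)$ is the number of conjugacy classes of $G$ whose elements have order $p^d$ for some $d \ge 1$, and $\tilde r(p,G) = r(p,G)+1$ (so $d=0$ is also allowed). For a sequence of finite groups $G_\bullet = (G_n)_{n\ge 0}$, $\widetilde{OGF}(p,G_\bullet,x) = \sum_{n\ge 0} \tilde r(p,G_n) x^n$ as a formal power series. $\nu_p$ is the $p$-adic valuation (exponent of the highest power of $p$ dividing the integer) and $|m|_p = p^{-\nu_p(m)}$ is the $p$-adic norm, regarded as a rational number. *)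

(* Defs.v *)
From HB Require Import structures.
From mathcomp Require Import all_boot all_order all_algebra all_fingroup.

Set Implicit Arguments.
Unset Strict Implicit.
Unset Printing Implicit Defensive.

Import GroupScope.

(* The exponent d is bounded by #|G| only to keep the quantifier boolean:
   p ^ d <= #|G| forces d < #|G| for p > 1 (see ppow_classesP). *)
Definition ppow_classes (p : nat) (gT : finGroupType) (G : {group gT}) :
    {set {set gT}} :=
  [set C in classes G |
    [exists d : 'I_#|G|, (0 < d) && [forall x in C, #[x] == (p ^ d)%N]]].

Lemma ppow_classesP (p : nat) (gT : finGroupType) (G : {group gT})
    (C : {set gT}) : 1 < p ->
  reflect (C \in classes G /\
           exists d : nat, 0 < d /\ forall x, x \in C -> #[x] = (p ^ d)%N)
          (C \in ppow_classes p G).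
Proof.
move=> p_gt1; rewrite inE; apply: (iffP andP) => -[CG].
  case/existsP=> d /andP[d_gt0 /forall_inP Cd]; split=> //.
  by exists d; split=> // x /Cd/eqP.
case=> d [d_gt0 Cd]; split=> //.
have [x Gx defC] := imsetP CG.
have ltdG : d < #|G|.
  apply: (@leq_trans #[x]); last by rewrite subset_leq_card ?cycle_subG.
  have /Cd -> : x \in C by rewrite defC class_refl.
  exact: ltn_expl.
apply/existsP; exists (Ordinal ltdG); rewrite d_gt0 /=.
by apply/forall_inP=> y /Cd->.
Qed.

Definition r (p : nat) (gT : finGroupType) (G : {group gT}) : nat :=
  #|ppow_classes p G|.

Definition r_tilde (p : nat) (gT : finGroupType) (G : {group gT}) : nat :=
  (r p G).+1.

(* Formal power series, given by their coefficient sequence: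
   PowerSeries (fun n => a n) is \sum_n a_n x^n. *)
Record powerseries (R : Type) := PowerSeries { pscoef : nat -> R }.

(* Coefficients are taken in rat, so that the series can be compared with one
   whose coefficients are inverses of p-adic norms. *)
Definition OGF_tilde (p : nat) (gT : nat -> finGroupType)
    (G : forall n, {group gT n}) : powerseries rat :=
  PowerSeries (fun n => (r_tilde p (G n))%:R%R).

Definition padic_val (p : nat) (m : int) : nat := logn p `|m|%N.

Definition padic_norm (p : nat) (m : int) : rat :=
  (if m == 0 then 0 else p%:R ^- padic_val p m)%R.

(* Zp m is a subgroup of 'Z_m, which is the ring Z/2 when m = 1; Zp 1 is
   however the trivial group, so Zp m is Z/m for every m > 0. *)
Definition Cyc (n : nat) : {group 'Z_(n.+1)} := Zp_group n.+1.

Definition BinCyc (n : nat) : {group 'Z_(2 * n.+1)} := Zp_group (2 * n.+1).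

(* Main.v *)
Require Import Defs.
From HB Require Import structures.
From mathcomp Require Import all_boot all_order all_algebra all_fingroup.
From mathcomp Require Import all_solvable.
From Stdlib Require Import FunctionalExtensionality.

(** In an abelian group conjugacy classes are singletons, so the classes of
    elements of order [p ^ d] with [d >= 1], together with the class of the
    identity, are counted by the elements of [p]-power order. These elements
    are exactly those of the Sylow [p]-subgroup ['O_p(G)], whose order is the
    [p]-part of [#|G|] ([r_tilde_abelian]). Both families consist of the
    cyclic groups [Z/m], for which this [p]-part is [p ^ v_p(m)], that is, the
    inverse of the [p]-adic norm of [m] ([inv_padic_norm]). *)

Local Open Scope ring_scope.

(** A nilpotent, in particular abelian, group has a unique Sylow
    [p]-subgroup, so membership in the [p]-core amounts to having [p]-power
    order; the identity is removed because the exponent [d] is positive. *)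
Lemma ppow_classes_abelian (p : nat) (gT : finGroupType) (G : {group gT}) :
  prime p -> abelian G ->
  ppow_classes p G = [set [set x] | x in ('O_p(G)^#)%g].
Proof.
move=> p_prime abelG.
have p_gt1 := prime_gt1 p_prime.
have sylG := nilpotent_pcore_Hall p (abelian_nil abelG).
have class1 := elimT (abelian_classP G) abelG.
apply/setP=> C; apply/(ppow_classesP _ _ p_gt1)/imsetP.
  case=> /imsetP[x Gx ->{C}] [d [d_gt0 Cd]]; exists x; last exact: class1.
  have ox := Cd x (class_refl G x).
  rewrite in_setD1 (mem_normal_Hall sylG (pcore_normal _ _) Gx).
  rewrite -order_gt1 ox -{1}(expn0 p) ltn_exp2l // d_gt0.
  by rewrite /p_elt ox pnatX pnat_id.
case=> x /setD1P[ntx Opx] ->{C}.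
have Gx := subsetP (pcore_sub p G) x Opx.
split; first by rewrite -class1 // mem_classes.
have [d ox] := p_natP (mem_p_elt (pcore_pgroup p G) Opx).
exists d; split=> [|y /set1P->//].
(* d = 0 would make x the identity. *)
case: d ox => // /eqP; rewrite expn0 order_eq1 => x1.
by rewrite x1 in ntx.
Qed.

Lemma r_tilde_abelian (p : nat) (gT : finGroupType) (G : {group gT}) :
  prime p -> abelian G -> r_tilde p G = (p ^ logn p #|G|)%N.
Proof.
move=> p_prime abelG.
rewrite /r_tilde /r ppow_classes_abelian // (card_imset _ set1_inj).
(* The successor in r_tilde puts the identity back into the p-core. *)
have := cardsD1 1%g 'O_p(G)%g; rewrite group1 add1n => <-.
by rewrite (card_Hall (nilpotent_pcore_Hall p (abelian_nil abelG))) p_part.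
Qed.

Lemma r_tilde_Zp (p m : nat) :
  prime p -> (0 < m)%N -> r_tilde p (Zp_group m) = (p ^ padic_val p m%:Z)%N.
Proof.
move=> p_prime m_gt0; rewrite r_tilde_abelian // ?card_Zp //.
by apply/centsP=> x _ y _; apply: Zp_mulgC.
Qed.

Lemma inv_padic_norm (p m : nat) :
  (0 < m)%N -> (p ^ padic_val p m%:Z)%N%:R = 1 / padic_norm p m%:Z.
Proof.
case: m => // m _.
by rewrite /padic_norm /= GRing.div1r GRing.invrK GRing.natrX.
Qed.

Theorem lemma3p1 (p : nat) (p_prime : prime p) :
  (OGF_tilde p Cyc
     = PowerSeries (fun n : nat => (p ^ padic_val p n.+1%:Z)%N%:R : rat)
   /\ PowerSeries (fun n : nat => (p ^ padic_val p n.+1%:Z)%N%:R : rat)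
     = PowerSeries (fun n : nat => 1 / padic_norm p n.+1%:Z))
  /\
  (OGF_tilde p BinCyc
     = PowerSeries (fun n : nat => (p ^ padic_val p (2 * n.+1)%N%:Z)%N%:R : rat)
   /\ PowerSeries (fun n : nat => (p ^ padic_val p (2 * n.+1)%N%:Z)%N%:R : rat)
     = PowerSeries (fun n : nat => 1 / padic_norm p (2 * n.+1)%N%:Z)).
Proof.
split; split; congr PowerSeries; apply: functional_extensionality => n.
- by rewrite r_tilde_Zp.
- exact: inv_padic_norm.
- by rewrite r_tilde_Zp.
- exact: inv_padic_norm.
Qed.
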